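(* Let $E$ be a (real) Riesz space. Then $E$ has the truncation band projection property if and only if $E$ has the principal projection property. Moreover, if $E$ has the principal projection property, then for every truncation $\tau$ on $E$ and every $z \in E^{+}$, the supremum below exists in $E$ and the band projection $P_{B_{[\tau]}}$ of $E$ onto the truncation band $B_{[\tau]}$ is given by $$P_{B_{[\tau]}}(z) = \sup_{n \in \mathbb{N}} \big( z \wedge n\,\tau(z) \big).$$
   Context: A truncation on a Riesz space $E$ is a map $\tau : E^{+} \to E^{+}$ such that $\tau(f) \wedge g = f \wedge \tau(g)$ for all $f, g \in E^{+}$. Its set of fixed points is $[\tau] = \{f \in E^{+} : \tau(f) = f\}$. The truncation band of $\tau$, denoted $B_{[\tau]}$, is the band of $E$ generated by $[\tau]$. $E$ has the truncation band projection property if the truncation band of every truncation on $E$ is a projection band. $E$ has the principal projection property if every principal band of $E$ (band generated by a single element) is a projection band. No Archimedean or completeness assumption is made on $E$. *)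

(* Defs.v *)
From HB Require Import structures.
From mathcomp Require Import all_boot all_order all_algebra.
From mathcomp Require Import mathcomp_extra boolp classical_sets reals.

Set Implicit Arguments.
Unset Strict Implicit.
Unset Printing Implicit Defensive.

Import Order.TTheory GRing.Theory Num.Theory.

Local Open Scope classical_set_scope.
Local Open Scope ring_scope.

(* An ordered vector space in which any two elements have an infimum and a
   supremum. The lattice operations sit in this mixin, and the library's lattice
   structure is derived below, because a structure inheriting both from
   GRing.Zmodule and from Order.Lattice ring_display cannot be declared after
   Num.RealDomain (missing join). *)
HB.mixin Record Lmodule_POrderedZmodule_isRiesz (R : realType) E
    of GRing.Lmodule R E & Num.POrderedZmodule E := {
  riesz_leD2r : forall z x y : E, x <= y -> x + z <= y + z;
  riesz_scale_ge0 : forall (a : R) (x : E), 0 <= a -> 0 <= x -> 0 <= a *: x;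
  riesz_meet : E -> E -> E;
  riesz_join : E -> E -> E;
  riesz_lexI : forall x y z : E, (x <= riesz_meet y z) = (x <= y) && (x <= z);
  riesz_leUx : forall x y z : E, (riesz_join x y <= z) = (x <= z) && (y <= z)
}.

#[short(type="rieszSpaceType")]
HB.structure Definition RieszSpace (R : realType) :=
  { E of GRing.Lmodule R E & Num.POrderedZmodule E
       & Lmodule_POrderedZmodule_isRiesz R E }.

#[non_forgetful_inheritance]
HB.instance Definition _ (R : realType) (E : rieszSpaceType R) :=
  Order.POrder_isMeetSemilattice.Build ring_display (RieszSpace.sort E)
    (@riesz_lexI R E).
#[non_forgetful_inheritance]
HB.instance Definition _ (R : realType) (E : rieszSpaceType R) :=
  Order.POrder_isJoinSemilattice.Build ring_display (RieszSpace.sort E)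
    (@riesz_leUx R E).

Section RieszSpaceDefs.
Context (R : realType) (E : rieszSpaceType R).
Implicit Types (x y f g : E) (A B D : set E).

Definition pos_cone := {f : E | 0 <= f}.

Definition riesz_abs x : E := (x `|` - x)%O.

Definition disjoint_complement A : set E :=
  [set x | forall y, A y -> (riesz_abs x `&` riesz_abs y)%O = 0].

Definition order_ideal A : Prop :=
  [/\ A 0,
      forall (a : R) x y, A x -> A y -> A (a *: x + y)
    & forall x y, A y -> riesz_abs x <= riesz_abs y -> A x].

Definition band B : Prop :=
  order_ideal B /\ forall D s, D `<=` B -> supremums D s -> B s.

Definition band_generated A : set E := smallest band A.

Definition projection_band B : Prop :=
  [/\ band B,
      forall x, exists u v, [/\ B u, disjoint_complement B v & x = u + v]
    & B `&` disjoint_complement B = [set 0]].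

(* The component of x in B along the disjoint complement of B; only meaningful
   when B is a projection band, where this component exists and is unique. *)
Definition band_projection B x : E :=
  xget 0 [set u | B u /\ disjoint_complement B (x - u)].

Definition truncation (tau : pos_cone -> pos_cone) : Prop :=
  forall f g : pos_cone,
    (val (tau f) `&` val g)%O = (val f `&` val (tau g))%O :> E.

Definition fixed_points (tau : pos_cone -> pos_cone) : set E :=
  [set val f | f in [set f : pos_cone | tau f = f]].

Definition truncation_band (tau : pos_cone -> pos_cone) : set E :=
  band_generated (fixed_points tau).

End RieszSpaceDefs.

Arguments pos_cone {R} E.

Definition truncation_band_projection_property
    (R : realType) (E : rieszSpaceType R) : Prop :=
  forall tau : pos_cone E -> pos_cone E,
    truncation tau -> projection_band (truncation_band tau).

Definition principal_projection_property
    (R : realType) (E : rieszSpaceType R) : Prop :=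
  forall f : E, projection_band (band_generated [set f]).

(* Main.v *)
Require Import Defs.
From mathcomp Require Import all_boot all_order all_algebra.
From mathcomp Require Import mathcomp_extra boolp classical_sets reals.

Set Implicit Arguments.
Unset Strict Implicit.
Unset Printing Implicit Defensive.

Import Order.TTheory GRing.Theory Num.Theory.

Local Open Scope classical_set_scope.
Local Open Scope ring_scope.

(** A truncation [tau] satisfies [tau z <= z] and is idempotent, so its fixed
    points are exactly its values, and [tau z] lies in the truncation band [B].

    If [E] has the principal projection property, fix [z >= 0], put
    [w = tau z] and split [z = p + q] along the principal band of [w] and its
    disjoint complement.  Then [p] lies in [B], because [w] does.  And [q] is
    disjoint from every fixed point [y]: as [0 <= q <= z] and [y = tau y],
    [q /\ y = q /\ (z /\ tau y) = q /\ (tau z /\ y) <= q /\ w = 0].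
    The elements disjoint from a given [q] form a band, so [q] is disjoint from
    all of [B]; hence [z = p + q] is also the decomposition of [z] along [B]
    (lemma [truncation_decomposition]).  Differences of positive elements then
    give the decomposition of an arbitrary element.

    Since the projection of [z] onto [B] is thus the projection onto the
    principal band of [w], the formula is the classical
    [p = sup_n (z /\ n w)] (lemma [principal_component_sup]).  It holds because
    the [x] for which [|x|] is the supremum of the [|x| /\ n w] form a band
    containing [w] (lemma [band_approximable]), hence containing [p].

    Conversely, [g |-> |f| /\ g] is a truncation whose fixed points are the
    positive elements below [|f|], so that its truncation band is the
    principal band of [f]. *)

(** * Order and lattice calculus in a Riesz space *)

Section RieszCalculus.
Context (R : realType) (E : rieszSpaceType R).
Implicit Types (x y z a b c : E).

Lemma riesz_lerD2r z x y : (x + z <= y + z) = (x <= y).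
Proof.
apply/idP/idP => [h|]; last exact: riesz_leD2r.
by have := riesz_leD2r (- z) _ _ h; rewrite !addrK.
Qed.

Lemma riesz_lerBlDr z x y : (x - z <= y) = (x <= y + z).
Proof. by rewrite -(riesz_lerD2r z (x - z) y) subrK. Qed.

Lemma riesz_lerBrDr z x y : (x <= y - z) = (x + z <= y).
Proof. by rewrite -(riesz_lerD2r z x (y - z)) subrK. Qed.

Lemma riesz_lerD x y a b : x <= y -> a <= b -> x + a <= y + b.
Proof.
move=> xy ab; apply: (@le_trans _ _ (y + a)); first by rewrite riesz_lerD2r.
by rewrite ![y + _]addrC riesz_lerD2r.
Qed.

Lemma riesz_lerDl x y : 0 <= y -> x <= x + y.
Proof. by move=> y0; rewrite -{1}[x]addr0 riesz_lerD. Qed.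

Lemma riesz_addr_ge0 x y : 0 <= x -> 0 <= y -> 0 <= x + y.
Proof. by move=> x0 y0; rewrite -[0]addr0 riesz_lerD. Qed.

Lemma riesz_mulrn_ge0 x n : 0 <= x -> 0 <= x *+ n.
Proof.
by move=> x0; elim: n => [|n IH]; rewrite ?mulr0n// mulrS riesz_addr_ge0.
Qed.

Lemma riesz_lerN2 x y : (- x <= - y) = (y <= x).
Proof.
by rewrite -(riesz_lerD2r (x + y) (- x)) addKr [x + y]addrC addKr.
Qed.

Lemma riesz_subr_ge0 x y : (0 <= y - x) = (x <= y).
Proof. by rewrite riesz_lerBrDr add0r. Qed.

Lemma riesz_ler_wscale (r : R) x y : 0 <= r -> x <= y -> r *: x <= r *: y.
Proof.
move=> r0 xy; rewrite -riesz_subr_ge0 -scalerBr riesz_scale_ge0//.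
by rewrite riesz_subr_ge0.
Qed.

Lemma riesz_meetDjoin x y : (x `&` y)%O + (x `|` y)%O = x + y.
Proof.
apply/eqP; rewrite eq_le; apply/andP; split.
- rewrite addrC -riesz_lerBrDr leUx !riesz_lerBrDr; apply/andP; split.
    by apply: riesz_lerD; rewrite ?leIr.
  by rewrite [x + y]addrC; apply: riesz_lerD; rewrite ?leIl.
- rewrite -riesz_lerBlDr lexI !riesz_lerBlDr; apply/andP; split.
    by apply: riesz_lerD; rewrite ?leUr.
  by rewrite addrC; apply: riesz_lerD; rewrite ?leUl.
Qed.

Lemma riesz_meetDl_le a b c : 0 <= a -> 0 <= b -> 0 <= c ->
  ((a + b) `&` c <= (a `&` c) + (b `&` c) :> E)%O.
Proof.
move=> a0 b0 c0; have ac0 : 0 <= (a `&` c)%O by rewrite lexI a0.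
rewrite [leRHS]addrC -riesz_lerBlDr lexI !riesz_lerBlDr; apply/andP; split.
  rewrite [leRHS]addrC -riesz_lerBlDr lexI !riesz_lerBlDr leIl/=.
  by apply: le_trans (riesz_lerDl _ b0); rewrite leIr.
by apply: le_trans (riesz_lerDl _ ac0); rewrite leIr.
Qed.

Lemma riesz_abs_ge x : x <= riesz_abs x.
Proof. exact: leUl. Qed.

Lemma riesz_abs_geN x : - x <= riesz_abs x.
Proof. exact: leUr. Qed.

Lemma riesz_abs_le x y : (riesz_abs x <= y) = (x <= y) && (- x <= y).
Proof. exact: leUx. Qed.

Lemma riesz_abs_ge0 x : 0 <= riesz_abs x.
Proof.
have h : 0 <= riesz_abs x + riesz_abs x.
  by rewrite -(subrr x) riesz_lerD ?riesz_abs_ge ?riesz_abs_geN.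
have := @riesz_scale_ge0 _ E (2^-1) _ _ h.
rewrite invr_ge0 ler0n => /(_ isT).
by rewrite -mulr2n -scaler_nat scalerA mulVf ?scale1r// pnatr_eq0.
Qed.

Lemma riesz_ge0_abs x : 0 <= x -> riesz_abs x = x.
Proof.
move=> x0; apply/eqP; rewrite eq_le riesz_abs_ge andbT riesz_abs_le lexx/=.
by apply: le_trans (x0); rewrite -riesz_lerN2 oppr0 opprK.
Qed.

Lemma riesz_abs0 : riesz_abs (0 : E) = 0.
Proof. exact: riesz_ge0_abs. Qed.

Lemma riesz_abs_id x : riesz_abs (riesz_abs x) = riesz_abs x.
Proof. by rewrite riesz_ge0_abs// riesz_abs_ge0. Qed.

Lemma riesz_absN x : riesz_abs (- x) = riesz_abs x.
Proof. by rewrite /riesz_abs opprK joinC. Qed.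

Lemma riesz_absD x y : riesz_abs (x + y) <= riesz_abs x + riesz_abs y.
Proof.
by rewrite riesz_abs_le opprD !riesz_lerD ?riesz_abs_ge ?riesz_abs_geN.
Qed.

Lemma riesz_absZ_le (r : R) x : riesz_abs (r *: x) <= `|r| *: riesz_abs x.
Proof.
have [r0|/ltW r0] := leP 0 r.
  rewrite ger0_norm// riesz_abs_le -scalerN.
  by rewrite !riesz_ler_wscale ?riesz_abs_ge ?riesz_abs_geN.
have r0' : 0 <= - r by rewrite oppr_ge0.
rewrite ler0_norm// -riesz_absN -scaleNr riesz_abs_le -scalerN.
by rewrite !riesz_ler_wscale ?riesz_abs_ge ?riesz_abs_geN.
Qed.

Lemma riesz_abs_eq0 x : riesz_abs x = 0 -> x = 0.
Proof.
move=> x0; apply/eqP; rewrite eq_le -{1}x0 riesz_abs_ge/=.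
by rewrite -riesz_lerN2 oppr0 -x0 riesz_abs_geN.
Qed.

(** Disjointness is an inequality, since the meet of two absolute values is
    always positive. *)
Lemma riesz_disjointE x y :
  (riesz_abs x `&` riesz_abs y)%O = 0 :> E <->
  (riesz_abs x `&` riesz_abs y)%O <= 0 :> E.
Proof.
split=> [->//|xy]; apply/eqP.
by rewrite eq_le xy lexI !riesz_abs_ge0.
Qed.

Lemma riesz_disjoint_le x y z : riesz_abs x <= riesz_abs z ->
  (riesz_abs z `&` riesz_abs y)%O = 0 :> E ->
  (riesz_abs x `&` riesz_abs y)%O = 0 :> E.
Proof.
move=> xz zy; apply/riesz_disjointE; rewrite -zy.
by rewrite lexI leIr andbT (le_trans _ xz)// leIl.
Qed.

End RieszCalculus.

(** * Bands *)

Section Bands.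
Context (R : realType) (E : rieszSpaceType R).
Implicit Types (x y z p q w : E) (A B K D : set E).

Definition solid K := forall x y, K y -> riesz_abs x <= riesz_abs y -> K x.

(** Scalars are absorbed by solidity, because [R] is Archimedean and [|r x|] is
    bounded by a multiple [n |x|].  As for suprema, the negative part of
    [sup D] is dominated by [|d|] for any [d] in [D], so that the positive part
    alone matters. *)
Lemma band_criterion K :
    K 0 -> solid K -> (forall x y, K x -> K y -> K (x + y)) ->
    (forall D s, D `<=` K -> supremums D s -> K (s `|` 0)%O) ->
  band K.
Proof.
move=> K0 Ks KD Ksup; split; first split=> //.
- move=> r x y Kx Ky; apply: (KD) => //.
  have Kn n : K (riesz_abs x *+ n).
    elim: n => [|n IH]; first by rewrite mulr0n.
    by rewrite mulrS; apply: (KD) => //; apply: (Ks) Kx _; rewrite riesz_abs_id.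
  apply: (Ks) (Kn (Num.bound `|r|)) _; apply: le_trans (riesz_absZ_le _ _) _.
  rewrite [leRHS]riesz_ge0_abs ?riesz_mulrn_ge0 ?riesz_abs_ge0//.
  rewrite -scaler_nat -riesz_subr_ge0 -scalerBl riesz_scale_ge0//.
    by rewrite subr_ge0 ltW// archi_boundP.
  exact: riesz_abs_ge0.
move=> D s DK sD; have [ubs lubs] := sD.
have [D0|/set0P[d Dd]] := eqVneq D set0.
  (* the supremum of the empty set is a least element of the space, hence 0 *)
  have sle x : s <= x by apply: lubs => y; rewrite D0.
  suff -> : s = 0 by [].
  apply/eqP; rewrite eq_le sle/=.
  by have := sle (s + s); rewrite -riesz_lerBlDr subrr.
have Kpd : K ((s `|` 0)%O + riesz_abs d).
  apply: KD; first exact: Ksup sD.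
  by apply: Ks (DK _ Dd) _; rewrite riesz_abs_id.
have p0 : 0 <= (s `|` 0 : E)%O by exact: leUr.
apply: Ks Kpd _; rewrite [leRHS]riesz_ge0_abs; last first.
  by rewrite riesz_addr_ge0// riesz_abs_ge0.
rewrite riesz_abs_le; apply/andP; split.
  by apply: le_trans (riesz_lerDl _ (riesz_abs_ge0 d)); exact: leUl.
rewrite addrC; apply: le_trans (riesz_lerDl _ p0).
by apply: le_trans (riesz_abs_geN d); rewrite riesz_lerN2 ubs.
Qed.

Lemma band_solid B : band B -> solid B.
Proof. by case=> -[]. Qed.

Lemma band0 B : band B -> B 0.
Proof. by case=> -[]. Qed.

Lemma bandD B x y : band B -> B x -> B y -> B (x + y).
Proof. by case=> -[_ lin _] _ Bx By; rewrite -[x]scale1r; apply: lin. Qed.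

Lemma bandN B x : band B -> B x -> B (- x).
Proof. by move=> /band_solid Bs Bx; apply: Bs Bx _; rewrite riesz_absN. Qed.

Lemma band_ge0_le B x y : band B -> B y -> 0 <= x -> x <= y -> B x.
Proof.
move=> /band_solid Bs By x0 xy; apply: Bs By _; rewrite riesz_ge0_abs//.
exact: le_trans (riesz_abs_ge _).
Qed.

Lemma band_mulrn B x n : band B -> B x -> B (x *+ n).
Proof.
move=> bB Bx; elim: n => [|n IH]; first by rewrite mulr0n; exact: band0.
by rewrite mulrS; exact: bandD.
Qed.

Lemma band_generated_band A : band (band_generated A).
Proof.
split; first split.
- by move=> B [[[]]].
- move=> r x y Ax Ay B BA; have [[[_ lin _] _] _] := BA.
  by apply: lin; [exact: Ax|exact: Ay].
- move=> x y Ay xy B BA; have [[[_ _ sol] _] _] := BA.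
  by apply: sol xy; exact: Ay.
- move=> D s DA sD B BA; have [[_ sup] _] := BA.
  by apply: sup sD => x /DA; apply.
Qed.

(** The supremum clause is the infinite distributive law in disguise: if every
    [d^+] with [d] in [D] is disjoint from [q = |y|], then
    [d + q <= d^+ \/ q <= s^+ \/ q], hence also [s^+ + q <= s^+ \/ q],
    which says that [s^+] is disjoint from [q]. *)
Lemma disjoint_complement_band A : band (disjoint_complement A).
Proof.
apply: band_criterion.
- move=> y _; apply/riesz_disjointE.
  by rewrite riesz_abs0 leIl.
- by move=> x z Az xz y Ay; apply: riesz_disjoint_le xz (Az _ Ay).
- move=> x z Ax Az y Ay.
  apply: (@riesz_disjoint_le _ _ _ _ (riesz_abs x + riesz_abs z)).
    rewrite [leRHS]riesz_ge0_abs ?riesz_addr_ge0 ?riesz_abs_ge0//.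
    exact: riesz_absD.
  apply/riesz_disjointE.
  rewrite riesz_ge0_abs ?riesz_addr_ge0 ?riesz_abs_ge0//.
  apply: le_trans (riesz_meetDl_le _ _ _) _; rewrite ?riesz_abs_ge0//.
  by rewrite Ax// Az// addr0.
- move=> D s DA [ubs lubs] y Ay; apply/riesz_disjointE.
  set q := riesz_abs y; have p0 : 0 <= (s `|` 0 : E)%O by exact: leUr.
  rewrite (riesz_ge0_abs p0); set p : E := (s `|` 0)%O in p0 *.
  have pq0 : 0 <= (p `|` q)%O - q by rewrite riesz_subr_ge0 leUr.
  suff : p <= (p `|` q)%O - q.
    by rewrite riesz_lerBrDr -riesz_meetDjoin -{2}[(p `|` q)%O]add0r riesz_lerD2r.
  rewrite /p leUx pq0 andbT; apply: lubs => d Dd.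
  rewrite riesz_lerBrDr.
  have d0 : 0 <= (d `|` 0 : E)%O by exact: leUr.
  have dq : ((d `|` 0) `&` q)%O = 0 :> E.
    rewrite -(riesz_ge0_abs d0); apply: riesz_disjoint_le (DA _ Dd _ Ay).
    by rewrite riesz_ge0_abs// leUx riesz_abs_ge riesz_abs_ge0.
  apply: (@le_trans _ _ ((d `|` 0)%O + q)); first by rewrite riesz_lerD2r leUl.
  rewrite -riesz_meetDjoin dq add0r leUx leUr andbT.
  rewrite leUx (le_trans p0 (leUl _ _)) andbT.
  by apply: le_trans (leUl _ _); apply: le_trans (leUl _ _); exact: ubs.
Qed.

(** An element disjoint from [A] is disjoint from the band generated by [A],
    because being disjoint from it defines a band that contains [A]. *)
Lemma disjoint_complement_generated A :
  disjoint_complement A `<=` disjoint_complement (band_generated A).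
Proof.
move=> q Aq y Ay.
suff : disjoint_complement [set q] y by move=> /(_ q erefl); rewrite meetC.
apply: Ay; split; first exact: disjoint_complement_band.
by move=> a Aa _ ->; rewrite meetC; exact: Aq.
Qed.

Lemma band_cap_disjoint_complement B : band B ->
  B `&` disjoint_complement B = [set 0].
Proof.
move=> bB; apply/seteqP; split=> [x [Bx /(_ _ Bx)]|_ ->].
  by rewrite meetxx => /riesz_abs_eq0.
by split; apply: band0 => //; exact: disjoint_complement_band.
Qed.

Lemma band_component_unique B x u v : band B ->
  B u -> disjoint_complement B (x - u) ->
  B v -> disjoint_complement B (x - v) -> u = v.
Proof.
move=> bB Bu du Bv dv; apply/eqP; rewrite -subr_eq0; apply/eqP.
suff : (B `&` disjoint_complement B) (u - v).
  by rewrite band_cap_disjoint_complement.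
split; first by apply: (bandD bB) => //; exact: (bandN bB).
have -> : u - v = (x - v) - (x - u) by rewrite opprB [RHS]addrC addrA subrK.
have bd := disjoint_complement_band B.
by apply: (bandD bd) => //; exact: (bandN bd).
Qed.

Lemma band_projectionE B x u : band B ->
  B u -> disjoint_complement B (x - u) -> band_projection B x = u.
Proof.
move=> bB Bu du; apply: xget_unique; first by split.
by move=> v [Bv dv]; apply: band_component_unique bB Bv dv Bu du.
Qed.

(** Every element is a difference of positive ones, so that positive elements
    are the only ones to decompose. *)
Lemma projection_band_ge0 B : band B ->
    (forall z, 0 <= z -> exists2 p, B p & disjoint_complement B (z - p)) ->
  projection_band B.
Proof.
move=> bB Bdec; split; [by []| |exact: band_cap_disjoint_complement].
move=> x; have [p Bp dp] := Bdec _ (riesz_abs_ge0 x).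
have [|p' Bp' dp'] := Bdec (riesz_abs x - x).
  by rewrite riesz_subr_ge0 riesz_abs_ge.
have bd := disjoint_complement_band B.
exists (p - p'), ((riesz_abs x - p) - (riesz_abs x - x - p')); split.
- by apply: (bandD bB) => //; exact: (bandN bB).
- by apply: (bandD bd) => //; exact: (bandN bd).
- by rewrite addrACA -opprD subrKC subrKC opprB subrKC.
Qed.

(** [- u] lies below [|u|] and, as [- u <= v], also below [|v|], hence below
    their meet [0]. *)
Lemma disjoint_sum_ge0 u v : (riesz_abs u `&` riesz_abs v)%O = 0 :> E ->
  0 <= u + v -> 0 <= u.
Proof.
move=> uv uv0; rewrite -riesz_lerN2 oppr0 -uv lexI riesz_abs_geN/=.
apply: le_trans (riesz_abs_ge v).
by rewrite -riesz_subr_ge0 opprK addrC.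
Qed.

(** If [|y| = sup (|y| /\ n w)] and [|x| <= |y|], then a bound [s] of all
    [|x| /\ n w] gives, by adding meets and joins,
    [|y| /\ n w + |x| <= s + |y|]; taking the supremum over [n] leaves
    [|x| <= s].  For sums, [|x| /\ n w + |y| /\ m w <= (|x| + |y|) /\ (n + m) w]
    and the two suprema are taken one after the other. *)
Lemma band_approximable w : 0 <= w ->
  band [set x : E | forall s,
    (forall n, (riesz_abs x `&` (w *+ n))%O <= s) -> riesz_abs x <= s].
Proof.
move=> w0; have wn0 n := riesz_mulrn_ge0 n w0.
set K := [set x | _].
have Ks : solid K.
  move=> x y Ky xy s xs; rewrite -(riesz_lerD2r (riesz_abs y)).
  rewrite [leLHS]addrC -riesz_lerBrDr; apply: Ky => n.
  rewrite riesz_lerBrDr -riesz_meetDjoin; apply: riesz_lerD.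
    by apply: le_trans (xs n); rewrite lexI leIr (le_trans (leIl _ _)) ?leIr.
  by rewrite leUx leIl.
apply: band_criterion => //.
- by move=> s /(_ 0%N); rewrite riesz_abs0 mulr0n meetxx.
- move=> x y Kx Ky; apply: (Ks _ (riesz_abs x + riesz_abs y)); last first.
    rewrite [leRHS]riesz_ge0_abs ?riesz_addr_ge0 ?riesz_abs_ge0//.
    exact: riesz_absD.
  rewrite /K/= riesz_ge0_abs ?riesz_addr_ge0 ?riesz_abs_ge0// => s xys.
  rewrite -riesz_lerBrDr; apply: Kx => n.
  rewrite riesz_lerBrDr addrC -riesz_lerBrDr; apply: Ky => m.
  rewrite riesz_lerBrDr; apply: le_trans (xys (m + n)%N).
  by rewrite lexI mulrnDr [riesz_abs x + _]addrC !riesz_lerD ?leIl ?leIr.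
- move=> D s DK [ubs lubs]; have p0 : 0 <= (s `|` 0 : E)%O by exact: leUr.
  rewrite /K/= (riesz_ge0_abs p0) => t pt.
  have t0 : 0 <= t.
    by apply: le_trans (pt 0%N); rewrite mulr0n lexI p0/=.
  rewrite leUx t0 andbT; apply: lubs => d Dd.
  have d0 : 0 <= (d `|` 0 : E)%O by exact: leUr.
  have Kd : K (d `|` 0)%O.
    apply: Ks (DK _ Dd) _.
    by rewrite riesz_ge0_abs// leUx riesz_abs_ge riesz_abs_ge0.
  apply: (@le_trans _ _ (d `|` 0)%O); first exact: leUl.
  rewrite -(riesz_ge0_abs d0).
  apply: Kd => n; apply: le_trans (pt n).
  rewrite riesz_ge0_abs// lexI leIr andbT; apply: le_trans (leIl _ _) _.
  by rewrite leUx p0 (le_trans (ubs _ Dd)) ?leUl.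
Qed.

(** An upper bound of the [z /\ n w] bounds the [p /\ n w], hence also [p] by
    [band_approximable].  Conversely [u = z /\ n w] is disjoint from [z - p],
    so [u = u /\ (p + (z - p)) <= u /\ p]. *)
Lemma principal_component_sup w z p : 0 <= w -> 0 <= z ->
  band_generated [set w] p ->
  disjoint_complement (band_generated [set w]) (z - p) ->
  [/\ 0 <= p, 0 <= z - p
    & supremums (range (fun n : nat => (z `&` (w *+ n))%O)) p].
Proof.
move=> w0 z0 Bp dq; have bB := band_generated_band [set w].
have Bw : band_generated [set w] w by exact: sub_gen_smallest.
have pq := dq _ Bp.
have p0 : 0 <= p.
  by apply: (@disjoint_sum_ge0 _ (z - p)); rewrite 1?meetC// subrKC.
have q0 : 0 <= z - p by apply: (@disjoint_sum_ge0 _ p) => //; rewrite subrK.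
split=> //; split=> [_ [n _ <-]|s ubs].
  have wn0 := riesz_mulrn_ge0 n w0.
  have u0 : 0 <= (z `&` (w *+ n))%O by rewrite lexI z0.
  have Bu : band_generated [set w] (z `&` (w *+ n))%O.
    by apply: band_ge0_le bB (band_mulrn n bB Bw) u0 _; rewrite leIr.
  have := dq _ Bu; rewrite !riesz_ge0_abs// => uq.
  set u : E := (z `&` (w *+ n))%O in u0 uq *.
  have uz : u <= (p + (z - p)) by rewrite subrKC leIl.
  have -> : u = ((p + (z - p)) `&` u)%O by apply/esym/meet_idPr.
  apply: le_trans (riesz_meetDl_le _ _ _) _ => //.
  by rewrite uq addr0 leIl.
move: Bp => /(_ _ (conj (band_approximable w0) _)); rewrite /= riesz_ge0_abs//.
apply=> [|n].
  by move=> _ -> t /(_ 1%N); rewrite mulr1n riesz_ge0_abs// meetxx.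
apply: (@le_trans _ _ (z `&` (w *+ n))%O); last by apply: ubs; exists n.
by rewrite lexI leIr andbT (le_trans (leIl _ _))// -riesz_subr_ge0.
Qed.

End Bands.

(** * Truncations *)

Section Truncations.
Context (R : realType) (E : rieszSpaceType R).
Implicit Types (f g : pos_cone E) (tau : pos_cone E -> pos_cone E).

(** Taking [g = tau f] in the truncation identity gives
    [tau f = f /\ tau (tau f)], hence [tau f <= f], and also
    [tau f <= tau (tau f) <= tau f]. *)
Lemma truncation_idem tau f : truncation tau -> tau (tau f) = tau f.
Proof.
move=> tr.
have tle g : val (tau g) <= val g.
  by have := tr g (tau g); rewrite meetxx => ->; rewrite leIl.
apply: val_inj; apply/eqP; rewrite eq_le tle/=.
by have := tr f (tau f); rewrite meetxx => ->; rewrite leIr.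
Qed.

Lemma truncation_band_val tau f : truncation tau ->
  truncation_band tau (val (tau f)).
Proof.
move=> tr; apply: sub_gen_smallest; exists (tau f) => //=.
exact: truncation_idem.
Qed.

(** The element [q = z - p] is disjoint from every fixed point [y], because
    [q <= z] and the truncation identity rewrites [z /\ y = z /\ tau y] as
    [tau z /\ y], which reduces [q /\ y] to [q /\ tau z /\ y = 0]. *)
Lemma truncation_decomposition tau (z : pos_cone E) p : truncation tau ->
    band_generated [set val (tau z)] p ->
    disjoint_complement (band_generated [set val (tau z)]) (val z - p) ->
  truncation_band tau p /\
  disjoint_complement (truncation_band tau) (val z - p).
Proof.
move=> tr Bp dq; have z0 := valP z; have w0 := valP (tau z).
have [p0 q0 _] := principal_component_sup w0 z0 Bp dq.
split.
  apply: Bp; split; first exact: band_generated_band.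
  by move=> _ ->; exact: truncation_band_val.
apply: disjoint_complement_generated => _ [y /= ty <-].
have y0 := valP y; apply/riesz_disjointE; rewrite !riesz_ge0_abs//.
have qw : ((val z - p) `&` val (tau z))%O = 0 :> E.
  have := dq _ (@sub_gen_smallest _ (@band R E) _ _ erefl).
  by rewrite !riesz_ge0_abs.
have qz : val z - p <= val z by rewrite riesz_lerBlDr riesz_lerDl.
have -> : ((val z - p) `&` val y = (val z - p) `&` (val (tau z) `&` val y) :> E)%O.
  by rewrite tr ty meetA (meet_idPl qz).
by rewrite meetA qw leIl.
Qed.

Lemma meet_abs_ge0 (x : E) f : 0 <= (riesz_abs x `&` val f)%O.
Proof. by rewrite lexI riesz_abs_ge0; exact: valP f. Qed.

(** The fixed points below show that every principal band is a truncation
    band. *)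
Definition meet_truncation (x : E) f : pos_cone E :=
  exist _ (riesz_abs x `&` val f)%O (meet_abs_ge0 x f).

Lemma meet_truncationP (x : E) : truncation (meet_truncation x).
Proof. by move=> f g /=; rewrite [X in (X `&` _)%O]meetC meetA. Qed.

Lemma fixed_points_meet_truncation (x : E) :
  fixed_points (meet_truncation x) = [set y | 0 <= y <= riesz_abs x].
Proof.
apply/seteqP; split=> [_ [f /= ff <-]|y /= /andP[y0 yx]].
  have f0 := valP f; rewrite f0/= -[X in X <= _](congr1 val ff).
  exact: leIl.
exists (exist _ y y0) => //=; apply: val_inj => /=; exact/meet_idPr.
Qed.

Lemma truncation_band_meet_truncation (x : E) :
  truncation_band (meet_truncation x) = band_generated [set x].
Proof.
rewrite /truncation_band fixed_points_meet_truncation.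
apply/seteqP; split; apply: smallest_sub; try exact: band_generated_band.
  move=> y /= /andP[y0 yx].
  apply: (band_solid (band_generated_band _)) (sub_gen_smallest erefl) _.
  by rewrite riesz_ge0_abs.
move=> _ ->; apply: (band_solid (band_generated_band _)) (riesz_abs x) _ _.
  by apply: sub_gen_smallest => /=; rewrite riesz_abs_ge0 lexx.
by rewrite riesz_abs_id.
Qed.

End Truncations.

Theorem theorem3p2 (R : realType) (E : rieszSpaceType R) :
  (truncation_band_projection_property E <-> principal_projection_property E)
  /\
  (principal_projection_property E ->
   forall (tau : pos_cone E -> pos_cone E), truncation tau ->
   forall z : pos_cone E,
     supremums (range (fun n : nat => (val z `&` (val (tau z) *+ n))%O : E))
       (band_projection (truncation_band tau) (val z))).
Proof.
have component (tau : pos_cone E -> pos_cone E) (z : pos_cone E) :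
    principal_projection_property E ->
    exists2 p, band_generated [set val (tau z)] p
      & disjoint_complement (band_generated [set val (tau z)]) (val z - p).
  move=> /(_ (val (tau z)))[_ /(_ (val z))[p [q [Bp dq zpq]]] _].
  by exists p => //; rewrite zpq addrC addKr.
split; first split=> [tbp f|ppp tau tr].
- by rewrite -truncation_band_meet_truncation; apply: tbp; exact: meet_truncationP.
- apply: projection_band_ge0; first exact: band_generated_band.
  move=> z z0; have [p Bp dq] := component tau (exist _ z z0) ppp.
  by have [] := truncation_decomposition tr Bp dq; exists p.
- move=> ppp tau tr z; have [p Bp dq] := component tau z ppp.
  have [Tp dT] := truncation_decomposition tr Bp dq.
  rewrite (band_projectionE (band_generated_band _) Tp dT).
  by have [] := principal_component_sup (valP (tau z)) (valP z) Bp dq.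
Qed.
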